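(* Let $G$ be a finite abelian group of prime power order. Then $\Gamma(G)$ is a chordal graph if and only if $G$ is (up to isomorphism) one of the following groups: (a) a cyclic group of prime power order; (b) $C_{p^k}\times C_p$, where $p$ is a prime and $k\ge 1$ is a natural number; (c) $C_p\times C_p\times C_p$, where $p$ is a prime.
   Context: For a finite group $G$, the co-maximal subgroup graph $\Gamma(G)$ is the simple undirected graph whose vertices are the non-trivial proper subgroups of $G$, two distinct vertices $H,K$ being adjacent if and only if $HK=G$, where $HK=\{hk: h\in H, k\in K\}$. A graph is chordal if it has no induced cycle of length $4$ or more. $C_n$, as a group, denotes the cyclic group of order $n$. *)

(* Defs.v *)
From HB Require Import structures.
From mathcomp Require Import all_boot all_fingroup all_algebra.

Set Implicit Arguments.
Unset Strict Implicit.
Unset Printing Implicit Defensive.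

(* The (uniq) sequence c lists the vertices of the cycle in cyclic order; in a
   simple graph it is induced when adjacent vertices are neighbours along c. *)
Definition induced_cycle (T : eqType) (e : rel T) (c : seq T) : Prop :=
  [/\ 2 < size c, ucycle e c
    & {in c &, forall x y, e x y -> (y == next c x) || (x == next c y)}].

Definition chordal (T : finType) (e : rel T) : Prop :=
  forall c : seq T, 4 <= size c -> ~ induced_cycle e c.

Section CoMaximalSubgroupGraph.

Variables (gT : finGroupType) (G : {group gT}).

Definition ntproper_subgroup : predArgType :=
  {H : {group gT} | (H \proper G) && (H :!=: 1%g)}.

HB.instance Definition _ := Finite.on ntproper_subgroup.

Definition comaximal : rel ntproper_subgroup :=
  fun H K => (H != K) && ((val H * val K)%g == G).

Lemma comaximal_irrefl : irreflexive comaximal.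
Proof. by move=> H; rewrite /comaximal eqxx. Qed.

Lemma comaximal_sym : symmetric comaximal.
Proof.
move=> H K; rewrite /comaximal eq_sym; congr andb.
have swap (A B : {group gT}) : (A * B)%g = G -> (B * A)%g = G.
  by move=> AB; rewrite -(invGid G) -AB invMg !invGid.
by apply/eqP/eqP; apply: swap.
Qed.

End CoMaximalSubgroupGraph.

Arguments comaximal {gT} G H K.

(* Main.v *)
Require Import Defs.
From HB Require Import structures.
From mathcomp Require Import all_boot all_fingroup all_algebra all_solvable.

(** The whole statement reduces to the presence of a split graph on one side
    and of an induced 4-cycle on the other.

    Sufficiency. A graph whose vertices are the union of an independent set and
    a clique is chordal ([split_graph_chordal]). In an abelian group two
    distinct subgroups of prime index are always adjacent, so it is enough to
    find an independent set of subgroups outside which all nontrivial proper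
    subgroups have prime index. If [exponent G] does not divide [m], the
    subgroups of exponent dividing [m] are independent; with [m = p ^ k.-1]
    this settles the cyclic group of order [p ^ k > 1] (nothing is left
    outside) and [C_(p ^ k) x C_p] (what is left outside has order [p ^ k]). In
    a group of order [p ^ 3] the subgroups of order [p] are independent, and
    the other nontrivial proper subgroups have order [p ^ 2].

    Necessity. Suppose [G = H x K] with [H] and [K] both nontrivial and not of
    prime order, and choose nontrivial proper subgroups [H1] of [H] and [K1] of
    [K]. Then [H], [K], [H K1], [K H1] is an induced 4-cycle, so the graph of
    [G] is not chordal ([chordal_dprod]). Applied to a decomposition of [G]
    into nontrivial cyclic groups of orders [n_1], [n_2], ..., each divisible
    by the next, this leaves at most three factors: with four or more, split
    off the product of the first two; with three, splitting off the first shows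
    that [n_1] is prime, hence all three orders are [p]; with two, one of the
    orders is prime, hence [n_2 = p]. *)

Set Implicit Arguments.
Unset Strict Implicit.
Unset Printing Implicit Defensive.

Local Open Scope group_scope.

(** * Chordal graphs *)

(** Two vertices at distance 2 along an induced cycle of length at least 4 are
    distinct and not adjacent. *)
Lemma induced_cycle_distance2 (T : finType) (e : rel T) (c : seq T) x :
    4 <= size c -> induced_cycle e c -> x \in c ->
  x != next c (next c x) /\ ~~ e x (next c (next c x)).
Proof.
move=> c_ge4 [_ /andP[_ Uc] ind_c] cx; set f := next c.
have neq_iter i y : 0 < i < 4 -> y \in c -> y != iter i f y.
  case/andP=> i_gt0 i_lt4 cy; have lt_i : i < fingraph.order f y.
    by rewrite (order_cycle (cycle_next Uc)) // (leq_trans i_lt4).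
  by apply: contraTneq i_gt0 => eq_y; rewrite -(findex_iter lt_i) -eq_y findex0.
have cf : f x \in c by rewrite mem_next.
split; first exact: (neq_iter 2).
apply/negP=> /ind_c; rewrite mem_next => /(_ cx cf) /orP[].
  by apply/negP; rewrite eq_sym; exact: (neq_iter 1%N (f x) isT cf).
by apply/negP; exact: (neq_iter 3 x isT cx).
Qed.

(** Along an induced cycle no two consecutive vertices lie in the independent
    set [I], and of two vertices two steps apart at least one lies in [I]; on a
    cycle of length at least 4 these requirements are incompatible. *)
Lemma split_graph_chordal (T : finType) (e : rel T) (I : pred T) :
    (forall x y, I x -> I y -> ~~ e x y) ->
    (forall x y, x != y -> ~~ I x -> ~~ I y -> e x y) ->
  chordal e.
Proof.
move=> indep clique c c_ge4 ind_c; set f := next c.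
have [_ /andP[cyc_c _] _] := ind_c.
have step x : x \in c -> ~~ (I x && I (f x)).
  move=> cx; apply/negP=> /andP[Ix Ifx].
  by have := indep _ _ Ix Ifx; rewrite (next_cycle cyc_c).
have two_steps x : x \in c -> I x || I (f (f x)).
  move=> cx; have [neq_x] := induced_cycle_distance2 c_ge4 ind_c cx.
  by apply: contraR; rewrite negb_or => /andP[]; apply: clique.
have cf x : x \in c -> f x \in c by rewrite mem_next.
have [x cx] : exists x, x \in c.
  by case: (c) c_ge4 => // x s _; exists x; rewrite mem_head.
(* If y were outside I, then f (f y) would be in I, hence f y and its second
   successor f (f (f y)) would both be outside I. *)
have all_I y : y \in c -> I y.
  move=> cy; apply: contraT => nIy; have /orP[/idPn//|I2] := two_steps _ cy.
  have:= two_steps _ (cf _ cy); have:= step _ (cf _ cy); rewrite I2 andbT.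
  move/negPf=> -> /= I3; have := step _ (cf _ (cf _ cy)).
  by rewrite I2 I3.
by have := step _ cx; rewrite !all_I ?cf.
Qed.

(** Two disjoint non-edges [a, a'] and [b, b'] joined by all four cross edges
    form an induced 4-cycle. *)
Lemma not_chordal_4cycle (T : finType) (e : rel T) a b a' b' :
    symmetric e -> irreflexive e -> a != a' -> b != b' ->
    e a b -> e b a' -> e a' b' -> e b' a -> ~~ e a a' -> ~~ e b b' ->
  ~ chordal e.
Proof.
move=> sym_e irr_e naa' nbb' eab eba' ea'b' eb'a neaa' nebb'.
have neq x y : e x y -> x != y.
  by apply: contraTneq => ->; rewrite irr_e.
have [nab nba' na'b' nb'a] :=
  And4 (neq _ _ eab) (neq _ _ eba') (neq _ _ ea'b') (neq _ _ eb'a).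
move/(_ [:: a; b; a'; b'] isT); apply; split=> //.
  rewrite /ucycle /= !inE eab eba' ea'b' eb'a !negb_or nab naa' nba' nbb' na'b'.
  by rewrite eq_sym nb'a.
have /negPf n1 := neaa'; have /negPf n2 := nebb'.
have n3 : e a' a = false by rewrite sym_e.
have n4 : e b' b = false by rewrite sym_e.
have /negPf q1 := nab; have /negPf q2 := naa'; have /negPf q3 := nba'.
have /negPf q4 := nbb'; have /negPf q5 := na'b'; have /negPf q6 := nb'a.
move=> x y; rewrite !inE => /or4P[] /eqP-> /or4P[] /eqP->;
  rewrite ?irr_e ?n1 ?n2 ?n3 ?n4 //= => _;
  by rewrite ?[b == a]eq_sym ?[a' == b]eq_sym ?[a' == a]eq_sym ?[b' == a']eq_sym
    ?[b' == b]eq_sym ?[a == b']eq_sym ?(q1, q2, q3, q4, q5, q6) ?eqxx ?orbT.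
Qed.

(** * Groups whose co-maximal subgroup graph is split *)

Section CoMaximal.

Variables (gT : finGroupType) (G : {group gT}).
Implicit Types H K A B : {group gT}.

Lemma mulg_prime_index H K : abelian G -> H \subset G -> K \subset G ->
  prime #|G : H| -> prime #|G : K| -> H != K -> H * K = G.
Proof.
move=> abG sHG sKG pH pK neqHK.
have maxG (L : {group gT}) : L \subset G -> prime #|G : L| -> maximal L G.
  by move=> sLG; apply: p_index_maximal.
apply: mulg_normal_maximal => //; first by rewrite -sub_abelian_normal.
  exact: maxG.
apply: contra neqHK => sKH; apply/eqP.
have /maxgroupP[_ maxK] := maxG K sKG pK.
apply/val_inj/maxK => //; exact: maxgroupp (maxG H sHG pH).
Qed.

Lemma mulg_exponent_dvdn H K m : abelian G -> H * K = G ->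
  exponent H %| m -> exponent K %| m -> exponent G %| m.
Proof.
move=> abG defG /exponentP eH /exponentP eK; apply/exponentP=> g.
have [sHG sKG] : H \subset G /\ K \subset G.
  by rewrite -defG mulG_subl mulG_subr.
rewrite -{1}defG => /mulsgP[h k Hh Kk ->].
rewrite expgMn; first by rewrite (eH h) // (eK k) // mulg1.
by apply: (centsP abG); [apply: (subsetP sHG) | apply: (subsetP sKG)].
Qed.

(** If the nontrivial proper subgroups outside an independent family [I] have
    prime index, then the co-maximal subgroup graph is split. *)
Lemma chordal_comaximal_split (I : pred {group gT}) : abelian G ->
    (forall H K, I H -> I K -> H \proper G -> K \proper G -> H * K != G) ->
    (forall H, H \proper G -> H :!=: 1 -> ~~ I H -> prime #|G : H|) ->
  chordal (comaximal G).
Proof.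
move=> abG indep clique.
apply: (@split_graph_chordal _ _ (fun u => I (val u))) => [H K IH IK | H K].
  rewrite /comaximal negb_and indep ?orbT //.
    by case/andP: (valP H).
  by case/andP: (valP K).
move=> neqHK nIH nIK; rewrite /comaximal neqHK /=; apply/eqP.
have [/andP[pH ntH] /andP[pK ntK]] := (valP H, valP K).
by apply: mulg_prime_index; rewrite ?proper_sub ?clique // (inj_eq val_inj).
Qed.

(** The independent set is made of the subgroups of exponent dividing [m]. *)
Lemma chordal_comaximal_exponent m : abelian G -> ~~ (exponent G %| m) ->
    (forall H, H \proper G -> ~~ (exponent H %| m) -> prime #|G : H|) ->
  chordal (comaximal G).
Proof.
move=> abG nGm primeI.
apply: (@chordal_comaximal_split [pred H : {group gT} | exponent H %| m]) => //=.
  move=> H K Hm Km _ _; apply: contra nGm => /eqP defG.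
  exact: mulg_exponent_dvdn defG Hm Km.
by move=> H pH _; apply: primeI.
Qed.

Lemma chordal_comaximal_cyclic p n : prime p -> #|G| = (p ^ n)%N -> cyclic G ->
  chordal (comaximal G).
Proof.
move=> p_pr oG cycG.
have abG := cyclic_abelian cycG.
have proper_dvd H : H \proper G -> 0 < n /\ #|H| %| (p ^ n.-1)%N.
  move=> pHG; have /(dvdn_pfactor _ _ p_pr)[i _ oH]: #|H| %| (p ^ n)%N.
    by rewrite -oG cardSg ?proper_sub.
  have := proper_card pHG; rewrite oG oH ltn_exp2l ?prime_gt1 // => lt_in.
  by rewrite (leq_trans _ lt_in) // dvdn_exp2l // -ltnS (ltn_predK lt_in).
(* The trivial group has no proper subgroup at all. *)
have [n0 | n_gt0] := posnP n.
  by apply: (@chordal_comaximal_split pred0) => // H /proper_dvd[]; rewrite n0.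
apply: (@chordal_comaximal_exponent (p ^ n.-1)) => //.
  by rewrite exponent_cyclic // oG dvdn_Pexp2l ?prime_gt1 // -ltnNge prednK.
by move=> H /proper_dvd[_ dvH]; rewrite (dvdn_trans (exponent_dvdn H) dvH).
Qed.

(** A proper subgroup whose exponent does not divide [p ^ k.-1] has exponent
    [p ^ k], hence order [p ^ k] and index [p]. *)
Lemma chordal_comaximal_exponent_index_p p k : prime p -> 0 < k -> abelian G ->
  #|G| = (p ^ k.+1)%N -> exponent G = (p ^ k)%N -> chordal (comaximal G).
Proof.
move=> p_pr k_gt0 abG oG eG.
apply: (@chordal_comaximal_exponent (p ^ k.-1)) => //.
  by rewrite eG dvdn_Pexp2l ?prime_gt1 // -ltnNge prednK.
move=> H pHG nHk; have sHG := proper_sub pHG.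
have /(dvdn_pfactor _ _ p_pr)[i _ eH]: exponent H %| (p ^ k)%N.
  by rewrite -eG exponentS.
have [j] : exists2 j, j <= k.+1 & #|H| = (p ^ j)%N.
  by apply/dvdn_pfactor; rewrite // -oG cardSg.
move=> _ oH.
have le_jk : j <= k.
  by have := proper_card pHG; rewrite oG oH ltn_exp2l ?prime_gt1.
have le_ij : i <= j.
  by rewrite -(dvdn_Pexp2l _ _ (prime_gt1 p_pr)) -eH -oH exponent_dvdn.
have le_ki : k <= i.
  by move: nHk; rewrite eH dvdn_Pexp2l ?prime_gt1 // -ltnNge; case: (k) k_gt0.
have jk : j = k by apply/eqP; rewrite eqn_leq le_jk (leq_trans le_ki).
suff -> : #|G : H| = p by [].
by rewrite -divgS // oG oH jk expnS mulnK // expn_gt0 prime_gt0.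
Qed.

(** The independent set is made of the subgroups of order [p], since a product
    of two of them has at most [p ^ 2] elements. *)
Lemma chordal_comaximal_p3 p : prime p -> abelian G -> #|G| = (p ^ 3)%N ->
  chordal (comaximal G).
Proof.
move=> p_pr abG oG; have p_gt1 := prime_gt1 p_pr.
apply: (@chordal_comaximal_split [pred H : {group gT} | #|H| == p]) => //=.
  move=> H K /eqP oH /eqP oK _ _; apply/eqP=> defG.
  have := mul_cardG H K; rewrite defG oH oK oG => /eqP.
  rewrite -(expnD p 1 1) eqn_leq => /andP[_].
  apply/negP; rewrite -ltnNge (@leq_trans (p ^ 3)) ?ltn_exp2l //.
  by rewrite leq_pmulr ?cardG_gt0.
move=> H pHG ntH noH; have sHG := proper_sub pHG.
have [j] : exists2 j, j <= 3 & #|H| = (p ^ j)%N.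
  by apply/dvdn_pfactor; rewrite // -oG cardSg.
move=> _ oH; rewrite -divgS // oG oH.
(* With H nontrivial, proper and not of order p, only j = 2 remains. *)
move: (proper_card pHG) noH; rewrite oG oH ltn_exp2l //.
have: #|H| != 1%N by rewrite -trivg_card1.
rewrite oH; case: j {oH} => [|[|[|//]]] //=; first by rewrite expn1 eqxx.
by rewrite (expnD p 1 2) mulnK ?expn_gt0 ?prime_gt0.
Qed.

(** * Induced 4-cycles from direct products *)

(** The induced 4-cycle is [A], [B], [A'], [B']. *)
Lemma not_chordal_two_chains A A' B B' : abelian G -> A * B = G ->
    A \proper A' -> A' \proper G -> B \proper B' -> B' \proper G ->
  ~ chordal (comaximal G).
Proof.
move=> abG defG pAA' pA'G pBB' pB'G.
have mulgG (H K : {group gT}) :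
    A \subset H -> H \subset G -> B \subset K -> K \subset G -> H * K = G.
  move=> sAH sHG sBK sKG; apply/eqP; rewrite eqEsubset mul_subG //=.
  by rewrite -defG mulgSS.
have [sAA' sA'G sBB' sB'G] := And4 (proper_sub pAA') (proper_sub pA'G)
                                   (proper_sub pBB') (proper_sub pB'G).
have [pAG pBG] := (proper_trans pAA' pA'G, proper_trans pBB' pB'G).
have neqG H : H \proper G -> H != G :> {set gT}.
  by case/properP=> _ [x Gx]; apply: contraNneq => ->.
have ntA : A :!=: 1.
  by apply: contraNneq (neqG _ pBG) => A1; rewrite -defG A1 mul1g.
have ntB : B :!=: 1.
  by apply: contraNneq (neqG _ pAG) => B1; rewrite -defG B1 mulg1.
have ntA' : A' :!=: 1 := subG1_contra sAA' ntA.
have ntB' : B' :!=: 1 := subG1_contra sBB' ntB.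
have vertex (H : {group gT}) : H \proper G -> H :!=: 1 ->
    exists v : ntproper_subgroup G, val v = H.
  move=> pHG ntH; have vH : (H \proper G) && (H :!=: 1) by rewrite pHG.
  by exists (Sub H vH); rewrite SubK.
have [[a va] [a' va']] := (vertex A pAG ntA, vertex A' pA'G ntA').
have [[b vb] [b' vb']] := (vertex B pBG ntB, vertex B' pB'G ntB').
have edge (u v : ntproper_subgroup G) :
    A \subset val u -> B \subset val v -> comaximal G u v.
  move=> sAu sBv; have [/andP[pu _] /andP[pv _]] := (valP u, valP v).
  have uvG : val u * val v = G.
    exact: mulgG sAu (proper_sub pu) sBv (proper_sub pv).
  rewrite /comaximal uvG eqxx andbT; apply/eqP=> uv.
  by move: uvG (neqG _ pu); rewrite -uv mulGid => ->; rewrite eqxx.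
have nonedge (u v : ntproper_subgroup G) :
    val u \proper val v -> u != v /\ ~~ comaximal G u v.
  move=> puv; have /andP[pv _] := valP v; split.
    by apply: contraTneq puv => ->; rewrite properxx.
  by rewrite /comaximal mulSGid ?proper_sub // negb_and neqG ?orbT.
have [naa' neaa'] : a != a' /\ ~~ comaximal G a a'.
  by apply: nonedge; rewrite va va'.
have [nbb' nebb'] : b != b' /\ ~~ comaximal G b b'.
  by apply: nonedge; rewrite vb vb'.
apply: (not_chordal_4cycle _ _ naa' nbb' _ _ _ _ neaa' nebb').
- exact: comaximal_sym.
- exact: comaximal_irrefl.
- by apply: edge; rewrite ?va ?vb.
- by rewrite comaximal_sym; apply: edge; rewrite ?va' ?vb.
- by apply: edge; rewrite ?va' ?vb'.
- by rewrite comaximal_sym; apply: edge; rewrite ?va ?vb'.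
Qed.

Lemma proper_ntsubgroup H : H :!=: 1 -> ~~ prime #|H| ->
  exists2 H1 : {group gT}, H1 :!=: 1 & H1 \proper H.
Proof.
move=> ntH npH; have p_pr : prime (pdiv #|H|) by rewrite pdiv_prime ?cardG_gt1.
have [x Hx ox] := Cauchy p_pr (pdiv_dvd _).
exists <[x]>%G; first by rewrite /= cycle_eq1 -order_gt1 ox prime_gt1.
rewrite properEcard cycle_subG Hx /= -[#|<[x]>|]/#[x] ox ltn_neqAle.
by rewrite pdiv_leq // andbT; apply: contraNneq npH => <-.
Qed.

(** If [H1] and [K1] are nontrivial proper subgroups of the factors [H] and
    [K], then the two chains [H < H <*> K1] and [K < K <*> H1] give an induced
    4-cycle. *)
Lemma chordal_dprod H K : abelian G -> H \x K = G -> chordal (comaximal G) ->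
  [\/ H :=: 1, K :=: 1, prime #|H| | prime #|K|].
Proof.
move=> abG defG chG.
have [H1|ntH] := eqVneq (H : {set _}) 1; first by constructor 1.
have [K1|ntK] := eqVneq (K : {set _}) 1; first by constructor 2.
have [pH|npH] := boolP (prime #|H|); first by constructor 3.
have [pK|npK] := boolP (prime #|K|); first by constructor 4.
have [H1 ntH1 pH1H] := proper_ntsubgroup ntH npH.
have [K1 ntK1 pK1K] := proper_ntsubgroup ntK npK.
have [_ HKG cHK tiHK] := dprodP defG.
have [sHG sKG] : H \subset G /\ K \subset G by rewrite -HKG mulG_subl mulG_subr.
have sH1G := subset_trans (proper_sub pH1H) sHG.
have sK1G := subset_trans (proper_sub pK1K) sKG.
have cardG : #|G| = (#|H| * #|K|)%N by rewrite -(dprod_card defG).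
have mul_lt (L M : {group gT}) : L \subset G -> M \subset G ->
    #|L| * #|M| < #|G| -> L <*> M \proper G.
  move=> sLG sMG lt; rewrite properEcard join_subG sLG sMG /=.
  rewrite cent_joinEr ?(sub_abelian_cent2 abG) //.
  by apply: leq_ltn_trans lt; rewrite mul_cardG leq_pmulr ?cardG_gt0.
have lt_join (L M : {group gT}) : L :&: M = 1 -> M :!=: 1 -> L \proper L <*> M.
  move=> tiLM ntM; rewrite properE joing_subl join_subG subxx /=.
  by apply: contra ntM => sML; rewrite -tiLM (setIidPr sML).
case: (@not_chordal_two_chains H (H <*> K1)%G K (K <*> H1)%G) => //.
- by apply: lt_join => //; apply/trivgP; rewrite -tiHK setIS ?proper_sub.
- by apply: mul_lt; rewrite // cardG ltn_pmul2l ?cardG_gt0 // proper_card.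
- apply: lt_join => //; rewrite setIC.
  by apply/trivgP; rewrite -tiHK setSI ?proper_sub.
- by apply: mul_lt; rewrite // cardG mulnC ltn_pmul2r ?cardG_gt0 // proper_card.
Qed.

End CoMaximal.

Lemma dprod_not_prime (gT : finGroupType) (G H K : {group gT}) :
  H \x K = G -> H :!=: 1 -> K :!=: 1 -> G :!=: 1 /\ ~~ prime #|G|.
Proof.
move=> defG ntH ntK; have [_ HKG _ _] := dprodP defG; split.
  by apply: subG1_contra ntH; rewrite -HKG mulG_subl.
rewrite -(dprod_card defG); apply/primePn; right.
rewrite -!cardG_gt1 in ntH ntK.
by exists #|H|; rewrite ?dvdn_mulr // ntH ltn_Pmulr ?(ltnW ntH).
Qed.

(** When the graph of [G] is chordal, a decomposition of [G] into nontrivial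
    cyclic factors has at most three of them; if there are two, one has prime
    order, and if there are three, the first has prime order.  The default
    branch is trivially true for at most one factor, and rules out four or
    more. *)
Lemma chordal_comaximal_dprod_cycles (gT : finGroupType) (G : {group gT})
    (s : seq gT) :
    abelian G -> chordal (comaximal G) -> \big[dprod/1]_(x <- s) <[x]> = G ->
    all (fun x => x != 1) s ->
  match s return Prop with
  | [:: x; y] => prime #[x] \/ prime #[y]
  | [:: x; y; z] => prime #[x]
  | _ => size s <= 1
  end.
Proof.
move=> abG chG; have chD := chordal_dprod abG _ chG.
have cyc1 (x : gT) : x != 1 -> <[x]> != 1 by rewrite cycle_eq1.
case: s => [|x [|y [|z [|t s]]]] //=; rewrite !big_cons.
- rewrite big_nil dprodg1 => defG /and3P[/cyc1/eqP ntx /cyc1/eqP nty _].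
  by case: (chD _ _ defG) => // p_pr; [left | right].
- rewrite big_nil dprodg1 => defG /and4P[/cyc1 ntx /cyc1 nty /cyc1 ntz _].
  have [[_ K _ defK] _ _ _] := dprodP defG; rewrite defK in defG.
  have [/eqP ntK npK] := dprod_not_prime defK nty ntz.
  case: (chD _ _ defG) => [/eqP | | |] //; first by rewrite (negPf ntx).
  by rewrite (negPf npK).
- (* The factors H = <[x]> \x <[y]> and K, the rest, are both composite. *)
  rewrite dprodA => defG /and5P[/cyc1 ntx /cyc1 nty /cyc1 ntz /cyc1 ntt _].
  have [[H K defH defK] _ _ _] := dprodP defG; rewrite defH defK in defG.
  have [/eqP ntH npH] := dprod_not_prime defH ntx nty.
  have [[_ L _ defL] _ _ _] := dprodP defK; rewrite defL in defK.
  have [[_ M _ defM] _ _ _] := dprodP defL; rewrite defM in defL.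
  have [_ tML _ _] := dprodP defL.
  have ntL : L :!=: 1 by apply: subG1_contra ntt; rewrite -tML mulG_subl.
  have [/eqP ntK npK] := dprod_not_prime defK ntz ntL.
  by case: (chD _ _ defG) => //; [rewrite (negPf npH) | rewrite (negPf npK)].
Qed.

(** * Concrete direct products *)

Lemma isog_dprod_setX (gT aT bT : finGroupType) (G H K : {group gT})
    (A : {group aT}) (B : {group bT}) :
  H \x K = G -> H \isog A -> K \isog B -> G \isog setX A B.
Proof.
move=> defG isoHA isoKB; apply: (isog_dprod defG (setX_dprod A B)).
  exact: isog_trans isoHA (isog_setX1 _ _).
exact: isog_trans isoKB (isog_set1X _ _).
Qed.

Lemma exponent_setX_Zp m n : 0 < m -> 0 < n ->
  exponent (setX (Zp m) (Zp n)) = lcmn m n.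
Proof.
move=> m_gt0 n_gt0.
rewrite -(dprod_exponent (setX_dprod [group of Zp m] [group of Zp n])).
have cycZp k : cyclic (Zp k).
  rewrite /Zp; case: ltnP => _; last exact: cyclic1.
  by rewrite Zp_cycle cycle_cyclic.
rewrite -(exponent_isog (isog_setX1 _ _)) -(exponent_isog (isog_set1X _ _)).
by rewrite !exponent_cyclic ?card_Zp.
Qed.

(** * The classification *)

Local Close Scope group_scope.
Unset Implicit Arguments.

Theorem theorem6p1 (gT : finGroupType) (G : {group gT}) (abG : abelian G)
    (ppG : exists p n : nat, prime p /\ #|G| = p ^ n) :
  chordal (comaximal G) <->
  [\/ (* (a) *) cyclic G /\ (exists p n : nat, prime p /\ #|G| = p ^ n),
      (* (b) *) exists p k : nat,
        [/\ prime p, 1 <= k & G \isog setX (Zp (p ^ k)) (Zp p)]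
    | (* (c) *) exists p : nat,
        prime p /\ G \isog setX (setX (Zp p) (Zp p)) (Zp p)].
Proof.
split=> [chG | [[cycG [p [n [p_pr oG]]]] | [p [k [p_pr k_gt0 isoG]]]
                | [p [p_pr isoG]]]].
- have [[|x s] defG ordG] := abelian_structure abG.
    by constructor 1; split=> //; rewrite -defG big_nil cyclic1.
  have [p [n [p_pr oG]]] := ppG.
  have gt1 := abelian_type_gt1 G; have sortG := abelian_type_dvdn_sorted G.
  rewrite -ordG in gt1 sortG.
  have nt_b : all (fun z => z != 1%g) (x :: s).
    apply/allP=> z bz; rewrite -order_gt1.
    by apply: (allP gt1); apply: map_f bz.
  have chs := chordal_comaximal_dprod_cycles abG chG defG nt_b.
  have sub_b z : z \in x :: s -> z \in G.
    move=> bz; rewrite -(bigdprodWY defG) (big_rem z) //=.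
    by apply/mem_gen; rewrite inE cycle_id.
  have order_pr z : z \in x :: s -> prime #[z]%g -> #[z]%g = p.
    move=> bz z_pr; have := order_dvdG (sub_b z bz).
    by rewrite oG Euclid_dvdX // dvdn_prime2 // => /andP[/eqP].
  have order_p z : z \in x :: s -> #[z]%g %| p -> #[z]%g = p.
    move=> bz dvz; have := allP nt_b z bz; rewrite -order_gt1 => z_gt1.
    have [_ /(_ _ dvz)/orP[/eqP z1|/eqP//]] := primeP p_pr.
    by rewrite z1 in z_gt1.
  case: s => [|y [|z [|? ?]]] //=
    in defG ordG gt1 sortG nt_b chs sub_b order_pr order_p *.
  + by constructor 1; split=> //; rewrite -defG big_seq1 cycle_cyclic.
  + rewrite big_cons big_seq1 in defG; have [dvyx _] := andP sortG.
    have oy : #[y]%g = p.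
      case: chs => [x_pr | y_pr].
        2: by apply: order_pr => //; rewrite !inE eqxx orbT.
      (* A prime order of x forces that of its nontrivial divisor. *)
      apply: order_p; first by rewrite !inE eqxx orbT.
      by rewrite -(order_pr x) ?mem_head.
    have Gx : x \in G by apply: sub_b; rewrite mem_head.
    have [k _ ox] : exists2 k, k <= n & #[x]%g = (p ^ k)%N.
      by apply/(dvdn_pfactor _ _ p_pr); rewrite -oG order_dvdG.
    constructor 2; exists p, k; split=> //.
      by move: gt1; rewrite ox; case: (k).
    by apply: (isog_dprod_setX defG); rewrite -?ox -?oy isog_sym Zp_isog.
  + rewrite !big_cons big_nil dprodg1 in defG; have [dvyx dvzy _] := and3P sortG.
    have ox : #[x]%g = p by apply: order_pr; rewrite ?mem_head.
    have oy : #[y]%g = p by apply: order_p; rewrite ?inE ?eqxx ?orbT // -ox.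
    have oz : #[z]%g = p by apply: order_p; rewrite ?inE ?eqxx ?orbT // -oy.
    constructor 3; exists p; split=> //.
    rewrite dprodA in defG.
    have [[H _ defH _] _ _ _] := dprodP defG; rewrite defH in defG.
    apply: (isog_dprod_setX defG); last by rewrite -oz isog_sym Zp_isog.
    by apply: (isog_dprod_setX defH); [rewrite -ox | rewrite -oy];
      rewrite isog_sym Zp_isog.
- exact: chordal_comaximal_cyclic p_pr oG cycG.
- have p_gt0 := prime_gt0 p_pr.
  have pk_gt0 : 0 < (p ^ k)%N by rewrite expn_gt0 p_gt0.
  apply: (chordal_comaximal_exponent_index_p p_pr k_gt0 abG).
    by rewrite (card_isog isoG) cardsX !card_Zp // expnSr.
  rewrite (exponent_isog isoG) exponent_setX_Zp //.
  by apply/lcmn_idPl; rewrite dvdn_exp.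
- apply: (chordal_comaximal_p3 p_pr abG).
  by rewrite (card_isog isoG) !cardsX !card_Zp ?prime_gt0 // !expnS mulnA muln1.
Qed.
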